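(* Let $p>3$ be prime, let $a,b\in\mathbb{Q}_p$ with $ab\neq 0$, and suppose $(a,b)\in\Delta_1\cup\Delta_3$. Consider the cubic equation $x^3+ax=b$ over $\mathbb{Q}_p$. Then: 1. It is solvable in $(\mathbb{Z}_p^* )^{[3]}$ iff $(a,b)\in\Delta_1$, $|b|_p=1$ and $p\equiv 1 \pmod 3$. 2. It is solvable in $(\mathbb{Z}_p\setminus\mathbb{Z}_p^* )^{[3]}$ iff either [$(a,b)\in\Delta_1$, $|b|_p<1$, $p\equiv 1\pmod 3$] or [$(a,b)\in\Delta_3$, $|a|_p<1$, $\sqrt{-a}$ exists]. 3. It is solvable in $(\mathbb{Q}_p\setminus\mathbb{Z}_p)^{[3]}$ iff either [$(a,b)\in\Delta_1$, $|b|_p>1$, $p\equiv 1\pmod 3$] or [$(a,b)\in\Delta_3$, $|b|_p>|a|_p$, $\sqrt{-a}$ exists]. 4. It is solvable in $(\mathbb{Z}_p\setminus\mathbb{Z}_p^* )^{[1]}\sqcup(\mathbb{Z}_p^* )^{[2]}$ iff $(a,b)\in\Delta_3$, $|a|_p=1$ and $\sqrt{-a}$ exists. 5. It is solvable in $(\mathbb{Z}_p^* )^{[1]}\sqcup(\mathbb{Q}_p\setminus\mathbb{Z}_p)^{[2]}$ iff $(a,b)\in\Delta_3$, $|a|_p=|b|_p$ and $\sqrt{-a}$ exists. 6. It is solvable in $(\mathbb{Z}_p\setminus\mathbb{Z}_p^* )^{[1]}\sqcup(\mathbb{Q}_p\setminus\mathbb{Z}_p)^{[2]}$ iff $(a,b)\in\Delta_3$,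 $|a|_p>|b|_p$, $|a|_p>1$ and $\sqrt{-a}$ exists. 7. It is solvable in $(\mathbb{Z}_p^* )^{[1]}$ iff either [$(a,b)\in\Delta_1$, $|b|_p=1$, $p\equiv 2\pmod 3$] or [$(a,b)\in\Delta_3$, $|a|_p=|b|_p$, $\sqrt{-a}$ does not exist]. 8. It is solvable in $(\mathbb{Z}_p\setminus\mathbb{Z}_p^* )^{[1]}$ iff either [$(a,b)\in\Delta_1$, $|b|_p<1$, $p\equiv 2\pmod 3$] or [$(a,b)\in\Delta_3$, $|a|_p>|b|_p$, $\sqrt{-a}$ does not exist]. 9. It is solvable in $(\mathbb{Q}_p\setminus\mathbb{Z}_p)^{[1]}$ iff either [$(a,b)\in\Delta_1$, $|b|_p>1$, $p\equiv 2\pmod 3$] or [$(a,b)\in\Delta_3$, $|a|_p<|b|_p$, $\sqrt{-a}$ does not exist].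
   Context: $\mathbb{Z}_p=\{x\in\mathbb{Q}_p:|x|_p\le1\}$, $\mathbb{Z}_p^*=\{x:|x|_p=1\}$. Every nonzero $c\in\mathbb{Q}_p$ is written $c=c^*/|c|_p$ with $c^*\in\mathbb{Z}_p^*$, $c^*=c_0+c_1p+c_2p^2+\cdots$, $c_0\in\{1,\dots,p-1\}$, $c_i\in\{0,\dots,p-1\}$. For nonzero $c$: ''$\sqrt{c}$ exists'' means $c_0^{(p-1)/2}\equiv 1\pmod p$ and $\log_p|c|_p$ is even; ''$\sqrt[3]{c}$ exists'' means $c_0^{(p-1)/\gcd(3,p-1)}\equiv 1\pmod p$ and $\log_p|c|_p$ is divisible by $3$ (equivalently, $x^2=c$, resp. $x^3=c$, is solvable in $\mathbb{Q}_p$). With $a_0,b_0$ the leading digits of $a^*,b^*$: $D_0=-4a_0^3-27b_0^2$, and integers $u_n$ are defined by $u_1=0,\ u_2=-a_0,\ u_3=b_0,\ u_{n+3}=b_0u_n-a_0u_{n+1}$. Sets: $\Delta_1=\{(a,b): |a|_p^3<|b|_p^2,\ \sqrt[3]{b}\text{ exists}\}$, $\Delta_2=\{(a,b): |a|_p^3=|b|_p^2,\ D_0u_{p-2}^2\not\equiv 9a_0^2 \pmod p\}$, $\Delta_3=\{(a,b): |a|_p^3>|b|_p^2\}$. Roots of $x^3+ax=b$ are taken in $\mathbb{Q}_p$ and counted with multiplicity. For $A\subset\mathbb{Q}_p$ and $n\in\{1,3\}$, ''solvable in $A^{[n]}$'' means the equation has exactly $n$ roots in $\mathbb{Q}_p$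 (with multiplicity) and all lie in $A$. For disjoint $A,B$ and $m,n>0$, $m+n=3$, ''solvable in $A^{[n]}\sqcup B^{[m]}$'' means exactly $n$ of its roots (with multiplicity) lie in $A$ and exactly $m$ lie in $B$. *)

(* Defs.v *)
From HB Require Import structures.
From mathcomp Require Import all_boot all_order all_algebra.
Set Implicit Arguments. Unset Strict Implicit. Unset Printing Implicit Defensive.
Import Order.TTheory GRing.Theory Num.Theory.
Local Open Scope ring_scope.

(* The field Q_p of p-adic numbers, given by its standard characterization *)
(* (unique up to isometric isomorphism): a field K with a norm nK : K -> Q *)
(* (the p-adic absolute value |.|_p) that is non-archimedean,              *)
(* multiplicative, with |p| = 1/p, in which Q is dense, and which is       *)
(* complete.                                                               *)
Record is_Qp (p : nat) (K : fieldType) (nK : K -> rat) : Prop := IsQp {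
  Qp_norm_ge0 : forall x, 0 <= nK x;
  Qp_norm_eq0 : forall x, nK x = 0 <-> x = 0;
  Qp_normM : forall x y, nK (x * y) = nK x * nK y;
  Qp_ultra : forall x y, nK (x + y) <= Num.max (nK x) (nK y);
  Qp_norm_p : nK (p%:R) = (p%:R)^-1;
  Qp_dense : forall (x : K) (eps : rat), 0 < eps ->
     exists r : rat, nK (x - ratr r) < eps;
  Qp_complete : forall u : nat -> K,
     (forall eps : rat, 0 < eps -> exists N, forall m n, (N <= m)%N -> (N <= n)%N ->
         nK (u m - u n) < eps) ->
     exists l : K, forall eps : rat, 0 < eps -> exists N, forall n, (N <= n)%N ->
         nK (u n - l) < eps
}.

Section Padic.
Variables (p : nat) (K : fieldType) (nK : K -> rat).

(* c^* = c / |c|_p = c * |c|_p (as |c|_p is rational) ; its leading digit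
   c_0 in {1,..,p-1} is the unique digit with |c^* - c_0|_p < 1. *)
Definition unit_part (c : K) : K := c * ratr (nK c).
Definition lead_digit (c : K) (d : nat) : Prop :=
  (0 < d < p)%N /\ nK (unit_part c - d%:R) < 1.

Definition log_norm (c : K) (k : int) : Prop := nK c = (p%:R : rat) ^ k.

Definition sqrt_exists (c : K) : Prop :=
  c != 0 /\ exists (d : nat) (k : int),
    [/\ lead_digit c d, (d ^ ((p - 1) %/ 2) %% p = 1)%N,
        log_norm c k & (2 %| k)%Z].

Definition cbrt_exists (c : K) : Prop :=
  c != 0 /\ exists (d : nat) (k : int),
    [/\ lead_digit c d, (d ^ ((p - 1) %/ gcdn 3 (p - 1)) %% p = 1)%N,
        log_norm c k & (3 %| k)%Z].

Definition Delta1 (a b : K) : Prop := nK a ^+ 3 < nK b ^+ 2 /\ cbrt_exists b.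
Definition Delta3 (a b : K) : Prop := nK a ^+ 3 > nK b ^+ 2.

Definition cubic (a b : K) : {poly K} := 'X^3 + a%:P * 'X - b%:P.

Definition root_multiset (P : {poly K}) (s : seq K) : Prop :=
  forall x, count_mem x s = mup x P.

Definition solvable_in (P : {poly K}) (A : pred K) (n : nat) : Prop :=
  exists s, root_multiset P s /\ size s = n /\ all A s.

Definition solvable_in2 (P : {poly K}) (A : pred K) (n : nat) (B : pred K) (m : nat) : Prop :=
  exists s, root_multiset P s /\ count A s = n /\ count B s = m.

Definition Zp_units : pred K := fun x => nK x == 1.
Definition Zp_nonunits : pred K := fun x => nK x < 1.
Definition Qp_nonint : pred K := fun x => 1 < nK x.

End Padic.

(* Main.v *)
Require Import Defs.
From HB Require Import structures.
From mathcomp Require Import all_boot all_order all_algebra.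
From mathcomp Require Import all_fingroup all_solvable all_field.
From mathcomp Require Import ring lra.
Import Order.TTheory GRing.Theory Num.Theory.
Local Open Scope ring_scope.

(* Hensel lifting produces one root r of the cubic: when |a|^3 < |b|^2 we scale
   by a cube root of b and lift the root 1 of z^3 = 1, and when |a|^3 > |b|^2 we
   scale by b/a and lift the root 1 of z = 1.  The other two roots exist iff
   -3r^2 - 4a, the discriminant of the quadratic cofactor, is a square.  In the
   first case it is -3 r^2 and in the second -4a, up to a factor 1 + t with
   |t| < 1, which is always a square; so the criterion is that -3 is a square,
   i.e. p = 1 mod 3, respectively that -a is a square.  The norms of the roots
   are |b|^(1/3) in the first case, and |b|/|a|, |a|^(1/2), |a|^(1/2) in the
   second. *)

(** * Power residues modulo [p] *)

(** The unit group of ['F_p] is cyclic of order [p - 1 = g * m] with [g = gcdn n (p - 1)]. If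
    [d = z ^ i] for a generator [z] and [d ^ m = 1], then [g] divides [i], and Bezout writes [g] as
    a multiple of [n] modulo [p - 1]. *)
Lemma power_residue (p n d : nat) : prime p -> (0 < n)%N ->
  (d ^ ((p - 1) %/ gcdn n (p - 1)) %% p = 1)%N -> (0 < d < p)%N ->
  exists e, (e ^ n = d %[mod p])%N.
Proof.
move=> hp n_gt0 dE /andP[d_gt0 dp].
have modFp (m k : nat) : m%:R = k%:R :> 'F_p -> (m = k %[mod p])%N.
  by move/(congr1 val); rewrite /= !val_Fp_nat.
have x0 : d%:R != 0 :> 'F_p.
  by apply/eqP => /(modFp d 0%N); rewrite mod0n modn_small // => d0; rewrite d0 in d_gt0.
set g := gcdn n (p - 1) in dE; set m := ((p - 1) %/ g)%N in dE.
have p1_gt0 : (0 < p - 1)%N by rewrite subn_gt0 prime_gt1.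
have gm : (g * m = p - 1)%N by rewrite mulnC divnK // dvdn_gcdr.
have m_gt0 : (0 < m)%N by move: p1_gt0; rewrite -gm muln_gt0 => /andP[].
have /cyclicP[z Ez] := field_unit_group_cyclic [set: {unit 'F_p}].
have oz : #[z]%g = (p - 1)%N.
  by rewrite /order -Ez card_finField_unit card_Fp // subn1.
pose U := finField_unit x0.
have /cycleP[i Ui] : U \in <[z]>%g by rewrite -Ez inE.
have : (z ^+ (i * m) == 1)%g.
  rewrite expgM -Ui -val_eqE /= FinRing.val_unitX /= -natrX -(Fp_nat_mod hp) dE.
  exact: eqxx.
rewrite -order_dvdn oz -gm dvdn_pmul2r // => /dvdnP[j Ei].
case: (egcdnP (p - 1) n_gt0) => u v Euv _.
(* With [i = j * g] and [u * n = v * (p - 1) + g], the [n]-th power of [z ^ (u * j)] is [z ^ i]. *)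
exists (val (val (z ^+ (u * j))%g)); apply: modFp.
rewrite natrX natr_Zp -FinRing.val_unitX -expgM.
have -> : (u * j * n = i + #[z]%g * (v * j))%N.
  by rewrite oz mulnAC Euv mulnDl Ei -/g (mulnC g) addnC mulnAC (mulnC _ (p-1)%N) mulnA.
by rewrite expgD expgM expg_order expg1n mulg1 -Ui.
Qed.

(** The square roots of -3 are the elements [2 * w + 1] with [w] a primitive cube root of unity, and
    such [w] exist in ['F_p] exactly when 3 divides [p - 1]. *)
Lemma minus3_residue (p : nat) : prime p -> (3 < p)%N ->
  (exists e, p %| e ^ 2 + 3)%N <-> (p %% 3 = 1)%N.
Proof.
move=> hp hp3.
have modFp (m : nat) : (m%:R == 0 :> 'F_p) = (p %| m)%N.
  by rewrite -val_eqE /= val_Fp_nat.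
have n2 : 2%:R != 0 :> 'F_p.
  by rewrite modFp gtnNdvd // (leq_trans _ hp3).
have n3 : 3%:R != 0 :> 'F_p by rewrite modFp gtnNdvd.
split=> [[e]|p3].
  rewrite -modFp natrD natrX => /eqP; set y : 'F_p := e%:R => y3.
  pose x := (y - 1) / 2%:R.
  have x0 : x ^+ 2 + x + 1 = 0.
    have -> : x ^+ 2 + x + 1 = (y ^+ 2 + 3%:R) / 2%:R / 2%:R.
      by rewrite /x; field; exact: n2.
    by rewrite y3 !mul0r.
  have x3 : x ^+ 3 = 1.
    apply/eqP; rewrite -subr_eq0.
    have -> : x ^+ 3 - 1 = (x - 1) * (x ^+ 2 + x + 1) by ring.
    by rewrite x0 mulr0.
  (* Fermat gives [x ^+ p = x], and [x ^+ 3 = 1] reduces the exponent; remainder 2 would force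
     [x = 1]. *)
  have : x ^+ (p %% 3) = x.
    by rewrite (expr_mod _ x3) -[RHS]expf_card card_Fp.
  have xN1 : x != 1.
    by apply: contra_neq n3 => x1; rewrite -x0 x1; ring.
  have xN0 : x != 0 by apply: contraNneq (oner_neq0 'F_p) => x0'; rewrite -x0 x0'; apply/eqP; ring.
  have : (p %% 3 < 3)%N by rewrite ltn_mod.
  have : (p %% 3 != 0)%N.
    by rewrite -/(3 %| p)%N dvdn_prime2 // neq_ltn hp3.
  case: (p %% 3)%N => [|[|[|]]] //= _ _ x2.
  by case/eqP: xN1; apply: (mulfI xN0); rewrite mulr1.
have c3 : (3 %| #|[set: {unit 'F_p}]|)%N.
  by rewrite card_finField_unit card_Fp // -subn1 -eqn_mod_dvd ?prime_gt0 // p3.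
have [w _ ow] := Cauchy (isT : prime 3) c3.
have w3 : val w ^+ 3 = 1 by rewrite -FinRing.val_unitX -ow expg_order.
have wN1 : val w - 1 != 0.
  rewrite subr_eq0; apply/eqP => w1; have : w = 1%g by apply: val_inj.
  by move=> w1'; rewrite w1' order1 in ow.
have {wN1}w0 : val w ^+ 2 + val w + 1 = 0.
  apply: (mulfI wN1); rewrite mulr0 -[RHS](subrr 1) -{3}w3; ring.
exists (val (2%:R * val w + 1)); rewrite -modFp natrD natrX natr_Zp.
have -> : (2%:R * val w + 1) ^+ 2 + 3%:R = 4%:R * (val w ^+ 2 + val w + 1) by ring.
by rewrite w0 mulr0.
Qed.

(** * Root multisets and the factorization of the cubic *)

Section RootMultiset.
Variable K : fieldType.
Implicit Types (P : {poly K}) (s : seq K) (A B : pred K).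

Lemma root_multiset_root P s x : root_multiset P s -> x \in s -> root P x.
Proof.
move=> Ps; rewrite -has_pred1 has_count Ps; apply: contraTT => /mupNroot ->.
by rewrite ltnn.
Qed.

Lemma root_multiset_perm P s t : root_multiset P s -> root_multiset P t -> perm_eq s t.
Proof. by move=> Ps Pt; apply/allP => x _ /=; rewrite Ps Pt. Qed.

(** A root multiset is unique up to permutation, so the existential can be tested on any list
    already known. *)
Lemma solvable_inE P s A n : root_multiset P s ->
  solvable_in P A n <-> size s = n /\ all A s.
Proof.
move=> Ps; split=> [[t [Pt [<- At]]]|[sn As]]; last by exists s.
have st := root_multiset_perm P s t Ps Pt.
by rewrite (perm_size st) (perm_all A st).
Qed.

Lemma solvable_in2E P s A n B m : root_multiset P s ->
  solvable_in2 P A n B m <-> count A s = n /\ count B s = m.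
Proof.
move=> Ps; split=> [[t [Pt [<- <-]]]|[sn As]]; last by exists s.
by rewrite !(seq.permP (root_multiset_perm P s t Ps Pt)).
Qed.

Lemma root_cubic (a b x : K) : root (cubic a b) x = (x ^+ 3 + a * x == b).
Proof. by rewrite /root /cubic !hornerE subr_eq0. Qed.

Lemma cubic_factor (a b r : K) : r ^+ 3 + a * r = b ->
  cubic a b = ('X - r%:P) * ('X^2 + r%:P * 'X + (r ^+ 2 + a)%:P).
Proof.
move=> <-; rewrite /cubic !polyCD !polyC_exp polyCM; ring.
Qed.

(** The cofactor of ['X - r%:P] is X^2 + rX + (r^2 + a), of discriminant -3r^2 - 4a; the other two
    roots come from the quadratic formula. Multiplicities are covered, since the cubic equals the
    product of the three linear factors. *)
Lemma cubic_roots3 (a b r v : K) : 2%:R != 0 :> K ->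
    r ^+ 3 + a * r = b -> v ^+ 2 = - 3%:R * r ^+ 2 - 4%:R * a ->
  root_multiset (cubic a b) [:: r; (v - r) / 2%:R; (- v - r) / 2%:R].
Proof.
move=> n2 rb va x; rewrite -mu_prod_XsubC !big_cons big_nil mulr1 (cubic_factor a b r rb).
congr (mup x (_ * _)).
set s := (v - r) / _; set t := (- v - r) / _.
have -> : r = - (s + t) by rewrite /s /t; field.
have -> : (- (s + t)) ^+ 2 + a = s * t.
  have -> : a = - (v ^+ 2 + 3%:R * r ^+ 2) / 2%:R / 2%:R by rewrite va; field.
  by rewrite /s /t; field.
by move: s t => s t; rewrite polyCN polyCM polyCD; ring.
Qed.

Lemma cubic_root1 (a b r : K) : r ^+ 3 + a * r = b ->
    (forall v, v ^+ 2 <> - 3%:R * r ^+ 2 - 4%:R * a) ->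
  root_multiset (cubic a b) [:: r].
Proof.
move=> rb nsq x; rewrite -mu_prod_XsubC big_seq1 (cubic_factor a b r rb) mupMl //.
apply/negP; rewrite /root !hornerE => /eqP x0'.
have x0 : x ^+ 2 + r * x + (r ^+ 2 + a) = 0 by rewrite addrA.
(* Completing the square: a root [x] of the cofactor makes [2x + r] a square root of its
   discriminant. *)
apply: (nsq (2%:R * x + r)).
have -> : (2%:R * x + r) ^+ 2 =
    4%:R * (x ^+ 2 + r * x + (r ^+ 2 + a)) - 3%:R * r ^+ 2 - 4%:R * a by ring.
by rewrite x0 mulr0 sub0r mulNr.
Qed.
End RootMultiset.


Lemma exp_lt_eps (c eps : rat) : 0 <= c < 1 -> 0 < eps ->
  exists N, forall n, (N <= n)%N -> c ^+ n < eps.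
Proof.
move=> /andP[c0 c1] eps0.
have h0 : 0 < 1 - c by rewrite subr_gt0.
(* A Bernoulli-type inequality: [c ^+ n] is at most 1 / (1 + n(1 - c)). *)
have bern n : (1 + n%:R * (1 - c)) * c ^+ n <= 1.
  elim: n => [|n IHn]; first by rewrite expr0; lra.
  have cn1 : c ^+ n.+1 <= 1 by apply: exprn_ile1 => //; exact: ltW.
  have := ler_wpM2r c0 IHn.
  have := ler_wpM2l (ltW h0) cn1.
  rewrite -natr1 exprS; lra.
have x0 : 0 <= (eps * (1 - c))^-1 by rewrite invr_ge0 ltW // mulr_gt0.
exists (Num.bound (eps * (1 - c))^-1) => n leNn.
have ltn : (eps * (1 - c))^-1 < n%:R.
  by apply: lt_le_trans (archi_boundP x0) _; rewrite ler_nat.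
have {ltn}h1 : 1 < n%:R * (1 - c) * eps.
  move: ltn; rewrite -[X in X < _]mul1r ltr_pdivrMr ?mulr_gt0 //.
  by rewrite (mulrC eps) mulrA.
have nh0 : 0 <= n%:R * (1 - c) by rewrite mulr_ge0 // ltW.
rewrite ltNge; apply/negP => le_eps.
have := ler_wpM2l (_ : 0 <= 1 + n%:R * (1 - c)) le_eps.
have := bern n.
move: h1 eps0 nh0; set t := n%:R * (1 - c); set e := c ^+ n.
move=> h1 eps0 t0 h2 /(_ _)h3; have /h3 : 0 <= 1 + t by lra.
lra.
Qed.

(** * The ultrametric norm and its values on integers *)

Section Qp.
Variables (p : nat) (K : fieldType) (nK : K -> rat).
Hypotheses (HK : is_Qp p nK) (hp : prime p).
Implicit Types x y z : K.

Let nK_ge0 := Qp_norm_ge0 HK.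
Let nKM := Qp_normM HK.

Lemma norm_eq0 x : (nK x == 0) = (x == 0).
Proof. by apply/eqP/eqP => /(Qp_norm_eq0 HK). Qed.

Lemma norm0 : nK 0 = 0.
Proof. by apply/eqP; rewrite norm_eq0. Qed.

Lemma norm_gt0 x : (0 < nK x) = (x != 0).
Proof. by rewrite lt_def norm_eq0 nK_ge0 andbT. Qed.

Lemma norm1 : nK 1 = 1.
Proof.
have nz : nK 1 != 0 by rewrite norm_eq0 oner_eq0.
by apply: (mulfI nz); rewrite -nKM !mulr1.
Qed.

Lemma normX x n : nK (x ^+ n) = nK x ^+ n.
Proof. by elim: n => [|n IHn]; rewrite ?norm1 // !exprS nKM IHn. Qed.

Lemma normN x : nK (- x) = nK x.
Proof.
rewrite -mulN1r nKM; suff -> : nK (-1) = 1 by rewrite mul1r.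
apply/eqP; rewrite -(eqrXn2 (n := 2)) ?ler01 ?nK_ge0 //.
by rewrite -normX sqrrN !expr1n norm1.
Qed.

Lemma normV x : nK x^-1 = (nK x)^-1.
Proof.
have [->|x0] := eqVneq x 0; first by rewrite invr0 norm0 invr0.
have nx0 : nK x != 0 by rewrite norm_eq0.
by apply: (mulfI nx0); rewrite -nKM !divff // norm1.
Qed.

Lemma normf_div x y : nK (x / y) = nK x / nK y.
Proof. by rewrite nKM normV. Qed.

Lemma normB x y : nK (x - y) = nK (y - x).
Proof. by rewrite -normN opprB. Qed.

Lemma normD_le x y c : nK x <= c -> nK y <= c -> nK (x + y) <= c.
Proof.
move=> hx hy; apply: le_trans (Qp_ultra HK x y) _.
by rewrite ge_max hx hy.
Qed.

Lemma normD_lt x y c : nK x < c -> nK y < c -> nK (x + y) < c.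
Proof.
move=> hx hy; apply: le_lt_trans (Qp_ultra HK x y) _.
by rewrite gt_max hx hy.
Qed.

(** If the sum were smaller than [y], then [y = (x + y) - x] would be a sum of two terms smaller
    than itself. *)
Lemma norm_dominant x y : nK x < nK y -> nK (x + y) = nK y.
Proof.
move=> lt_xy; apply/eqP; rewrite eq_le normD_le ?(ltW lt_xy) //=.
rewrite leNgt; apply/negP => lt_sum.
have := @normD_lt (x + y) (- x) (nK y) lt_sum.
by rewrite normN lt_xy addrC addKr ltxx => /(_ isT).
Qed.

Lemma norm_near x y : nK (x - y) < nK y -> nK x = nK y.
Proof. by move=> /norm_dominant; rewrite subrK. Qed.

Lemma normM_le1 x y : nK x <= 1 -> nK y <= 1 -> nK (x * y) <= 1.
Proof. by move=> hx hy; rewrite nKM mulr_ile1. Qed.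

Lemma norm_nat_le1 n : nK n%:R <= 1.
Proof.
elim: n => [|n IHn]; first by rewrite norm0.
by rewrite -natr1 normD_le // norm1.
Qed.

Lemma norm_p_lt1 : nK p%:R < 1.
Proof. by rewrite (Qp_norm_p HK) invf_lt1 ?ltr1n ?ltr0n ?prime_gt0 ?prime_gt1. Qed.

Lemma norm_nat_dvd n : (p %| n)%N -> nK n%:R < 1.
Proof.
case/dvdnP=> m ->; rewrite natrM nKM.
by apply: le_lt_trans norm_p_lt1; rewrite ler_piMl // norm_nat_le1.
Qed.

(** Bezout gives [u * n = v * p + 1], which has norm 1; both factors on the left have norm at most
    1, so both have norm 1. *)
Lemma norm_nat_coprime n : ~~ (p %| n)%N -> nK n%:R = 1.
Proof.
move=> ndvd; have n_gt0 : (0 < n)%N by case: n ndvd; rewrite ?dvdn0.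
have co : gcdn n p = 1%N.
  by apply/eqP; rewrite gcdnC -/(coprime p n) prime_coprime.
case: (egcdnP p n_gt0) => u v; rewrite co => Euv _.
have : nK (u * n)%:R = 1.
  rewrite Euv natrD -norm1; apply: norm_dominant.
  by rewrite norm1 norm_nat_dvd ?dvdn_mull.
rewrite natrM nKM => E.
apply/eqP; rewrite eq_le norm_nat_le1 /= -E ler_piMl //.
exact: norm_nat_le1.
Qed.

Lemma norm_nat_lt1 n : (nK n%:R < 1) = (p %| n)%N.
Proof.
by case: (boolP (p %| n)%N) => [/norm_nat_dvd //|/norm_nat_coprime ->]; rewrite ltxx.
Qed.

Lemma norm_natB m n : (nK (m%:R - n%:R) < 1) = (m == n %[mod p]).
Proof.
have [le_nm|/ltnW le_mn] := leqP n m.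
  by rewrite -natrB // norm_nat_lt1 eqn_mod_dvd.
by rewrite normB -natrB // norm_nat_lt1 eq_sym eqn_mod_dvd.
Qed.

(** * Newton iteration and Hensel lifting *)

(** Newton's method with the slope frozen at the unit [d]. The difference quotient [q] of [f] stays
    within [c] of [d] on the closed ball of radius [c], so each step multiplies the bound on [f] by
    [c]. *)
Lemma newton_contraction (f : K -> K) (q : K -> K -> K) (d x0 : K) (c : rat) :
    c < 1 -> nK d = 1 ->
    (forall x y, f x - f y = (x - y) * q x y) ->
    (forall x y, nK (x - x0) <= c -> nK (y - x0) <= c -> nK (q x y - d) <= c) ->
    nK (f x0) <= c ->
  exists l, f l = 0 /\ nK (l - x0) <= c.
Proof.
move=> c1 d1 fq qd fx0; have c0 : 0 <= c by exact: le_trans (nK_ge0 _) fx0.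
have d0 : d != 0 by rewrite -norm_eq0 d1 oner_eq0.
pose g x := x - f x / d; pose u n := iter n g x0.
have stepE n : u n.+1 - u n = - (f (u n) / d) by rewrite /u /= /g addrC addKr.
have step n : nK (u n.+1 - u n) = nK (f (u n)).
  by rewrite stepE normN normf_div d1 divr1.
have inv n : nK (u n - x0) <= c /\ nK (f (u n)) <= c ^+ n.+1.
  elim: n => [|n [IH1 IH2]]; first by rewrite subrr norm0 expr1.
  have cn : c ^+ n.+1 <= c.
    by rewrite exprS ler_piMr // exprn_ile1 // ltW.
  have H1 : nK (u n.+1 - x0) <= c.
    have -> : u n.+1 - x0 = (u n.+1 - u n) + (u n - x0) by ring.
    by rewrite normD_le // step (le_trans IH2).
  split=> //.
  have -> : f (u n.+1) = - (f (u n) / d) * (q (u n.+1) (u n) - d).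
    rewrite mulrBr -stepE -fq stepE; field; exact: d0.
  rewrite nKM normN normf_div d1 divr1 exprSr.
  by rewrite ler_pM // qd.
(* By the ultrametric inequality a difference of iterates is bounded by its largest single step. *)
have cauchy n k : nK (u (n + k)%N - u n) <= c ^+ n.
  elim: k => [|k IHk]; first by rewrite addn0 subrr norm0 exprn_ge0.
  have -> : u (n + k.+1)%N - u n = (u (n + k).+1 - u (n + k)%N) + (u (n + k)%N - u n).
    by rewrite addnS; ring.
  rewrite normD_le // step; apply: le_trans (proj2 (inv _)) _.
  by rewrite -addnS exprD ler_piMr ?exprn_ge0 // exprn_ile1 // ltW.
have c01 : 0 <= c < 1 by rewrite c0.
have [l lim] : exists l : K, forall eps : rat, 0 < eps ->
    exists N, forall n, (N <= n)%N -> nK (u n - l) < eps.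
  apply: (Qp_complete HK) => eps /(exp_lt_eps _ _ c01)[N HN].
  exists N => m n leNm leNn.
  have -> : u m - u n = (u m - u N) - (u n - u N) by ring.
  apply: normD_lt; rewrite ?normN.
    by rewrite -(subnKC leNm); apply: le_lt_trans (cauchy _ _) (HN _ _).
  by rewrite -(subnKC leNn); apply: le_lt_trans (cauchy _ _) (HN _ _).
have lx0 : nK (l - x0) <= c.
  rewrite leNgt; apply/negP => lt_c.
  have [N /(_ N (leqnn N)) HN] := lim _ (le_lt_trans c0 lt_c).
  have E : l - x0 = (u N - x0) - (u N - l) by ring.
  have : nK (l - x0) < nK (l - x0).
    by rewrite {1}E normD_lt ?normN // (le_lt_trans (proj1 (inv N))).
  by rewrite ltxx.
exists l; split=> //.
(* If [f l] were nonzero, an iterate [u n] with both [f (u n)] and [u n - l] smaller than [f l]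
   would make [f l] smaller than itself. *)
apply/eqP/contraT; rewrite -norm_gt0 => fl_gt0.
have [N1 HN1] := lim _ fl_gt0; have [N2 HN2] := exp_lt_eps _ _ c01 fl_gt0.
pose n := maxn N1 N2.
have qle : nK (q (u n) l) <= 1.
  rewrite -[q _ _](subrK d) normD_le ?d1 //.
  by apply: le_trans (ltW c1); apply: qd => //; exact: (proj1 (inv n)).
have : nK (f l) < nK (f l); last by rewrite ltxx.
have {1}-> : f l = f (u n) - (u n - l) * q (u n) l by rewrite -fq; ring.
apply: normD_lt; rewrite ?normN.
  apply: le_lt_trans (proj2 (inv n)) (HN2 _ _).
  by rewrite (leq_trans (leq_maxr N1 N2)).
rewrite nKM; apply: le_lt_trans (HN1 n (leq_maxl _ _)).
by rewrite ler_piMr.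
Qed.

(** Coefficients are left general so that square roots, cube roots and the rescaled cubics are all
    instances. The radius is the norm of the value at [x0], and the slope is the derivative
    there. *)
Lemma hensel_cubic (e g h k x0 : K) :
    nK e <= 1 -> nK g <= 1 -> nK x0 <= 1 ->
    nK (e * x0 ^+ 3 + g * x0 ^+ 2 + h * x0 + k) < 1 ->
    nK (3%:R * e * x0 ^+ 2 + 2%:R * g * x0 + h) = 1 ->
  exists x, e * x ^+ 3 + g * x ^+ 2 + h * x + k = 0 /\ nK (x - x0) < 1.
Proof.
move=> e1 g1 x1 fx0 dfx0.
pose f x := e * x ^+ 3 + g * x ^+ 2 + h * x + k.
pose q x y := e * (x ^+ 2 + x * y + y ^+ 2) + g * (x + y) + h.
have fq x y : f x - f y = (x - y) * q x y by rewrite /f /q; ring.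
have [||x [fx xx0]] := newton_contraction f q _ x0 _ fx0 dfx0 fq.
- move=> x y; set c := nK _ in fx0 *.
  set s := x - x0; set t := y - x0 => hx hy.
  have s1 : nK s <= 1 by apply: le_trans (ltW fx0).
  have t1 : nK t <= 1 by apply: le_trans (ltW fx0).
  have n3 := norm_nat_le1 3.
  (* The deviation of [q] from the derivative is a combination of [s] and [t] with integral
     coefficients. *)
  have -> : q x y - (3%:R * e * x0 ^+ 2 + 2%:R * g * x0 + h) =
      s * (e * (s + t + 3%:R * x0) + g) + t * (e * (t + 3%:R * x0) + g).
    by rewrite /q /s /t; ring.
  by apply: normD_le; rewrite nKM -[c]mulr1 ler_pM //;
    do ![apply: normD_le => // | apply: normM_le1 => //].
- exact: lexx.
by exists x; split=> //; exact: le_lt_trans fx0.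
Qed.

(** * Value group and leading digits *)

Lemma norm_nat_pow n : (0 < n)%N -> nK n%:R = p%:R ^ (- (logn p n)%:Z).
Proof.
move=> n_gt0; rewrite -{1}(partnC p n_gt0) natrM nKM p_part natrX normX.
rewrite (Qp_norm_p HK) norm_nat_coprime ?mulr1; first by rewrite exprVn exprnN.
by rewrite -prime_coprime // (pnat_coprime (pi := p)) ?part_pnat ?pnat_id.
Qed.

Lemma p_neq0 (F : numDomainType) : p%:R != 0 :> F.
Proof. by rewrite pnatr_eq0 -lt0n prime_gt0. Qed.

Lemma norm_int (z : int) : nK z%:~R = nK (absz z)%:R.
Proof. by case: (intP z) => [|n|n] //; rewrite mulrNz normN abszN. Qed.

Lemma natr_neq0 n : (0 < n)%N -> n%:R != 0 :> K.
Proof.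
by move=> n_gt0; rewrite -norm_eq0 norm_nat_pow // expfz_neq0 // p_neq0.
Qed.

Lemma intr_neq0 (z : int) : z != 0 -> z%:~R != 0 :> K.
Proof. by move=> z0; rewrite -norm_eq0 norm_int norm_eq0 natr_neq0 // absz_gt0. Qed.

(** [ratr] uses the reduced fraction; cross multiplication carries over to [K] because nonzero
    integers stay nonzero there. *)
Lemma ratr_divz (m n : int) : n != 0 -> ratr (m%:~R / n%:~R) = m%:~R / n%:~R :> K.
Proof.
move=> n0; pose x : rat := m%:~R / n%:~R; rewrite /ratr -/x.
have n0Q : n%:~R != 0 :> rat by rewrite intr_eq0.
have : (numq x)%:~R / (denq x)%:~R = m%:~R / n%:~R :> rat by rewrite divq_num_den.
move/eqP; rewrite eqr_div ?intr_eq0 ?denq_neq0 //.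
rewrite -!intrM eqr_int => /eqP E.
by apply/eqP; rewrite eqr_div ?intr_neq0 ?denq_neq0 // -!intrM E.
Qed.

Lemma ratr_ppow (k : int) : ratr (p%:R ^ k) = p%:R ^ k :> K.
Proof.
have pp n : (p%:R ^+ n)%R = (p ^ n)%N%:Z%:~R :> rat by rewrite -natrX.
have ppK n : (p%:R ^+ n)%R = (p ^ n)%N%:Z%:~R :> K by rewrite -natrX.
have pn0 n : (p ^ n)%N%:Z != 0 by rewrite -lt0n expn_gt0 prime_gt0.
case: (intP k) => [|n|n]; first by rewrite !expr0z (ratr_int _ 1).
  by rewrite -!exprnP pp ppK ratr_int.
rewrite -!exprnN pp ppK; have := ratr_divz 1 _ (pn0 n.+1).
by rewrite !div1r.
Qed.

Lemma norm_ppow (k : int) : nK (p%:R ^ k) = p%:R ^ (- k).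
Proof.
case: (intP k) => [|n|n]; first by rewrite !expr0z norm1.
  by rewrite -exprnP normX (Qp_norm_p HK) exprVn exprnN.
by rewrite -exprnN normV normX (Qp_norm_p HK) exprVn invrK opprK.
Qed.

(** By density some rational is closer to [x] than the norm of [x], hence has the same norm, and
    norms of nonzero rationals are powers of [p]. *)
Lemma value_group x : x != 0 -> exists k : int, nK x = p%:R ^ k.
Proof.
rewrite -norm_gt0 => nx_gt0.
have [r] := Qp_dense HK x nx_gt0; rewrite normB => /norm_near E.
have : nK (ratr r) != 0 by rewrite E gt_eqF.
move: E; rewrite normf_div mulf_eq0 negb_or !norm_int !norm_eq0 => E /andP[n0 _].
have nn : (0 < `|numq r|)%N by case: `|numq r|%N n0; rewrite ?eqxx.
have dn : (0 < `|denq r|)%N by rewrite absz_gt0 denq_neq0.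
rewrite -E !norm_nat_pow // invr_expz -expfzDr ?p_neq0 //.
by eexists.
Qed.

Lemma int_digit (z : int) : exists2 d, (d < p)%N & nK (z%:~R - d%:R) < 1.
Proof.
have p0 : (p%:Z != 0) by rewrite -lt0n prime_gt0.
exists `|(z %% p)%Z|%N.
  by rewrite -ltz_nat gez0_abs ?modz_ge0 // ltz_pmod // ltz_nat prime_gt0.
rewrite [X in z%:~R - X](_ : _ = (z %% p)%Z%:~R); last first.
  by rewrite -[in RHS](gez0_abs (modz_ge0 _ p0)).
rewrite {1}(divz_eq z p) intrD addrK intrM nKM.
apply: le_lt_trans norm_p_lt1; rewrite ler_piMl //.
by rewrite norm_int norm_nat_le1.
Qed.

(** The residue field is ['F_p]: approximate [u] by a fraction, invert its denominator modulo [p],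
    and reduce the resulting integer. *)
Lemma digit_near_unit u : nK u = 1 -> exists2 d, (0 < d < p)%N & nK (u - d%:R) < 1.
Proof.
move=> u1; have [r ur] := Qp_dense HK u ltr01.
have r1 : nK (ratr r) = 1.
  by rewrite -u1; apply: norm_near; rewrite u1 normB.
have := r1; rewrite normf_div !norm_int.
set n := `|numq r|%N; set m := `|denq r|%N => E.
have m_gt0 : (0 < m)%N by rewrite absz_gt0 denq_neq0.
have nm : nK n%:R = nK m%:R.
  by rewrite -[RHS]mul1r -E divfK // norm_eq0 natr_neq0.
have pm : ~~ (p %| m)%N.
  (* Numerator and denominator have equal norm and are coprime, so [p] divides neither. *)
  apply/negP => pm; have pn : (p %| n)%N by rewrite -norm_nat_lt1 nm norm_nat_lt1.
  have := dvdn_gcd p n m; rewrite pn pm (eqP (coprime_num_den r)).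
  by rewrite dvdn1 => /eqP p1; move: hp; rewrite p1.
case: (egcdnP p m_gt0) => v w.
rewrite (_ : gcdn m p = 1%N); last first.
  by apply/eqP; rewrite gcdnC -/(coprime p m) prime_coprime.
move=> Evw _.
have mE : (denq r)%:~R = m%:R :> K by rewrite -[denq r]gez0_abs // denq_ge0.
have rE : ratr r = (numq r)%:~R / m%:R :> K by rewrite -mE.
have m0 : m%:R != 0 :> K by exact: natr_neq0.
have rv : nK (ratr r - (numq r * v)%:~R) < 1.
  have -> : ratr r - (numq r * v)%:~R = - (ratr r * (w * p)%:R) :> K.
    have : (v%:R * m%:R : K) = (w * p)%:R + 1 by rewrite -natrM Evw natrD.
    rewrite rE intrM -[v%:~R]/(v%:R) => Ev.
    have -> : (w * p)%:R = v%:R * m%:R - 1 :> K by rewrite Ev addrK.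
    by field.
  by rewrite normN nKM r1 mul1r norm_nat_lt1 dvdn_mull.
have [d dp Hd] := int_digit (numq r * v).
have ud : nK (u - d%:R) < 1.
  have -> : u - d%:R = (u - ratr r) + (ratr r - (numq r * v)%:~R)
    + ((numq r * v)%:~R - d%:R) by ring.
  by do 2!apply: normD_lt => //.
exists d => //; rewrite dp andbT lt0n; apply: contraTneq ud => ->.
by rewrite subr0 u1 ltxx.
Qed.

Lemma unit_part_norm c k : nK c = p%:R ^ k -> nK (c * p%:R ^ k) = 1.
Proof. by move=> ck; rewrite nKM ck norm_ppow -expfzDr ?p_neq0 // subrr expr0z. Qed.

Lemma pK_neq0 : p%:R != 0 :> K.
Proof. by rewrite natr_neq0 // prime_gt0. Qed.

(** * Squares and cubes in [K] *)

(** Turns the digit and valuation conditions into an approximate [n]-th root [e] of a unit that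
    differs from [c] by the [n]-th power of a power of [p]: the starting point for Hensel
    lifting. *)
Lemma unit_part_power n c d k : (0 < n)%N ->
    lead_digit p nK c d -> (d ^ ((p - 1) %/ gcdn n (p - 1)) %% p = 1)%N ->
    log_norm p nK c k -> (n %| k)%Z ->
  exists (e : nat) (j : int),
    nK e%:R = 1 /\ nK (e%:R ^+ n - c * (p%:R ^ j) ^+ n) < 1.
Proof.
move=> n_gt0 [dp cd] dE ck /dvdzP[j kE].
have [e eE] := power_residue p n d hp n_gt0 dE dp.
have ecd : nK (e%:R ^+ n - c * (p%:R ^ j) ^+ n) < 1.
  have -> : c * (p%:R ^ j) ^+ n = unit_part nK c.
    by rewrite /unit_part ck ratr_ppow kE -exprz_exp -exprnP.
  have -> : e%:R ^+ n - unit_part nK c =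
      (e%:R ^+ n - d%:R) - (unit_part nK c - d%:R) by ring.
  by apply: normD_lt; rewrite ?normN // -natrX norm_natB; apply/eqP.
exists e, j; split=> //.
have u1 : nK (c * (p%:R ^ j) ^+ n) = 1.
  by rewrite -(unit_part_norm c k ck) kE -exprz_exp -exprnP.
have /norm_near : nK (e%:R ^+ n - c * (p%:R ^ j) ^+ n) < nK (c * (p%:R ^ j) ^+ n).
  by rewrite u1.
by rewrite u1 normX => /eqP; rewrite pexpr_eq1 // => /eqP.
Qed.

Hypothesis hp3 : (3 < p)%N.

Lemma norm2 : nK 2%:R = 1.
Proof. by rewrite norm_nat_coprime // gtnNdvd // (leq_trans _ hp3). Qed.

Lemma norm3 : nK 3%:R = 1.
Proof. by rewrite norm_nat_coprime // gtnNdvd. Qed.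

Lemma two_neq0 : 2%:R != 0 :> K.
Proof. exact: natr_neq0. Qed.

Lemma hensel_sqrt c x0 : nK x0 = 1 -> nK (x0 ^+ 2 - c) < 1 ->
  exists x, x ^+ 2 = c /\ nK (x - x0) < 1.
Proof.
move=> x1 xc; have [|||||x [fx xx0]] := hensel_cubic 0 1 0 (- c) x0.
- by rewrite norm0.
- by rewrite norm1.
- by rewrite x1.
- by move: xc; rewrite !mul0r add0r mul1r addr0.
- by rewrite mulr0 mul0r add0r addr0 mulr1 nKM norm2 x1 mul1r.
exists x; split=> //; apply/eqP; rewrite -subr_eq0 -fx; apply/eqP; ring.
Qed.

Lemma hensel_depressed a c x0 : nK a < 1 -> nK x0 = 1 -> nK (x0 ^+ 3 - c) < 1 ->
  exists x, x ^+ 3 + a * x = c /\ nK (x - x0) < 1.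
Proof.
move=> a1 x1 xc; have [|||||x [fx xx0]] := hensel_cubic 1 0 a (- c) x0.
- by rewrite norm1.
- by rewrite norm0.
- by rewrite x1.
- have -> : 1 * x0 ^+ 3 + 0 * x0 ^+ 2 + a * x0 - c = (x0 ^+ 3 - c) + a * x0 by ring.
  by apply: normD_lt => //; rewrite nKM x1 mulr1.
- have -> : 3%:R * 1 * x0 ^+ 2 + 2%:R * 0 * x0 + a = a + 3%:R * x0 ^+ 2 by ring.
  have n1 : nK (3%:R * x0 ^+ 2) = 1 by rewrite nKM normX norm3 x1 expr1n mulr1.
  by rewrite norm_dominant n1.
exists x; split=> //; apply/eqP; rewrite -subr_eq0 -fx; apply/eqP; ring.
Qed.

Lemma sqrt_existsP c : c != 0 -> sqrt_exists p nK c <-> exists y, y ^+ 2 = c.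
Proof.
move=> c0; have podd : (gcdn 2 (p - 1) = 2)%N.
  apply/gcdn_idPl; rewrite dvdn2 oddB ?prime_gt0 //.
  by case: (even_prime hp) (hp3) => [->|->].
have pj0 (j : int) : p%:R ^ j != 0 :> K by rewrite expfz_neq0 // pK_neq0.
split=> [[_ [d [k [cd dE ck k2]]]]|[y yc]].
  have [|e [j [e1 ec]]] := unit_part_power 2 c d k isT cd _ ck k2.
    by rewrite podd.
  have [y [yc _]] := hensel_sqrt _ _ e1 ec.
  by exists (y / p%:R ^ j); rewrite exprMn yc exprVn mulfK // expf_neq0.
have y0 : y != 0 by apply: contraNneq c0 => y0; rewrite -yc y0 expr0n.
split=> //; have [j yj] := value_group y y0.
have [e /andP[e0 ep] ey] := digit_near_unit _ (unit_part_norm _ _ yj).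
have e1 : nK e%:R = 1 by rewrite norm_nat_coprime // gtnNdvd.
have cj : nK c = p%:R ^ (j * 2) by rewrite -yc normX yj -exprz_exp -exprnP.
have pNe : ~~ (p %| e ^ 2)%N by rewrite Euclid_dvdX // gtnNdvd.
(* The leading digit of [y ^+ 2] is the square of that of [y] modulo [p], and it passes the residue
   test by Fermat's little theorem. *)
exists (e ^ 2 %% p)%N, (j * 2); split=> //.
- split; first by rewrite lt0n pNe ltn_mod prime_gt0.
  have -> : unit_part nK c = (y * p%:R ^ j) ^+ 2.
    by rewrite /unit_part cj ratr_ppow -yc exprMn -exprz_exp -exprnP.
  set v := y * _ in ey *.
  have -> : v ^+ 2 - (e ^ 2 %% p)%N%:R =
     (v - e%:R) * (v + e%:R) + ((e ^ 2)%N%:R - (e ^ 2 %% p)%N%:R).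
    by rewrite natrX; ring.
  apply: normD_lt; last by rewrite norm_natB modn_mod.
  rewrite nKM; apply: le_lt_trans ey; rewrite ler_piMr //.
  by rewrite normD_le // ?e1 // (unit_part_norm _ _ yj).
- rewrite modnXm -expnM mulnC divnK; last by apply/gcdn_idPl.
  rewrite subn1 -totient_prime // Euler_exp_totient; last first.
    by rewrite coprime_sym prime_coprime // gtnNdvd.
  by rewrite modn_small // prime_gt1.
- by apply/dvdzP; exists j.
Qed.

Lemma cbrt_exists_cube c : cbrt_exists p nK c -> exists y, y ^+ 3 = c.
Proof.
move=> [c0 [d [k [cd dE ck k3]]]].
have [e [j [e1 ec]]] := unit_part_power 3 c d k isT cd dE ck k3.
have [|y [yc _]] := hensel_depressed 0 _ _ _ e1 ec; first by rewrite norm0.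
exists (y / p%:R ^ j); move: yc; rewrite mul0r addr0 exprMn => ->.
by rewrite exprVn mulfK // expf_neq0 // expfz_neq0 // pK_neq0.
Qed.

Lemma minus3_square : (exists y : K, y ^+ 2 = - 3%:R) <-> (p %% 3 = 1)%N.
Proof.
rewrite -minus3_residue //; split=> [[y y3]|[e pe]].
  have y1 : nK y = 1.
    apply/eqP; rewrite -(pexpr_eq1 (n := 2)) // -normX y3 normN norm3 //.
  have [e _ ey] := digit_near_unit _ y1.
  exists e; rewrite -norm_nat_lt1 natrD natrX.
  have -> : e%:R ^+ 2 + 3%:R = - (y - e%:R) * (y + e%:R) by rewrite mulNr -subr_sqr y3; ring.
  rewrite nKM normN; apply: le_lt_trans ey; rewrite ler_piMr //.
  by rewrite normD_le // ?y1 // norm_nat_le1.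
have [||y [y3 _]] := hensel_sqrt (- 3%:R) e%:R; last by exists y.
- rewrite norm_nat_coprime //; apply: contraTN pe => pe.
  by rewrite (dvdn_addr 3 (dvdn_exp _ pe)) // gtnNdvd.
- by rewrite opprK -natrX -natrD norm_nat_lt1.
Qed.

(** Leading digit and exponent exist and are unique, so the condition reduces to a boolean test on
    them; no excluded middle is assumed. *)
Lemma sqrt_exists_dec c : c != 0 -> sqrt_exists p nK c \/ ~ sqrt_exists p nK c.
Proof.
move=> c0; have [k ck] := value_group c c0.
have uE : unit_part nK c = c * p%:R ^ k by rewrite /unit_part ck ratr_ppow.
have [d dp cd] := digit_near_unit _ (unit_part_norm _ _ ck).
have [/andP[/eqP dE k2]|nE] :=
  boolP ((d ^ ((p - 1) %/ 2) %% p == 1)%N && (2 %| k)%Z).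
  by left; split=> //; exists d, k; split=> //; split; rewrite ?uE.
right=> -[_ [d' [k' [[/andP[_ dp'] cd'] dE' ck' k2']]]]; case/negP: nE.
have p_gt0 : 0 < p%:R :> rat by rewrite ltr0n prime_gt0.
have pN1 : p%:R != 1 :> rat by rewrite pnatr_eq1 neq_ltn prime_gt1 ?orbT.
have kk : k = k' by apply: (ieexprIz p_gt0 pN1); rewrite -ck -ck'.
have dd : d = d'.
  have : nK (d%:R - d'%:R) < 1.
    have -> : d%:R - d'%:R = (unit_part nK c - d'%:R) - (c * p%:R ^ k - d%:R).
      by rewrite uE; ring.
    by rewrite normD_lt ?normN.
  by case/andP: dp => _ dp; rewrite norm_natB !modn_small // => /eqP.
by rewrite dd kk dE' k2' eqxx.
Qed.

Lemma sqrt_one_plus t : nK t < 1 -> exists w, nK w = 1 /\ w ^+ 2 = 1 + t.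
Proof.
move=> t1; have [||w [ww w1]] := hensel_sqrt (1 + t) 1.
- exact: norm1.
- by rewrite expr1n opprD addrA subrr sub0r normN.
by exists w; split=> //; rewrite -norm1; apply: norm_near; rewrite norm1.
Qed.

(** * Number and norms of the roots in each region *)

(** If |a| < |x|^2 the term x^3 dominates. Otherwise |b| is at most |a||x|, so |b|^2 is at most
    |a|^2|x|^2 and hence at most |a|^3, a contradiction. *)
Lemma norm_root_Delta1 a b x : nK a ^+ 3 < nK b ^+ 2 -> x ^+ 3 + a * x = b ->
  nK x ^+ 3 = nK b.
Proof.
move=> ab xb; have [ax|xa] := ltP (nK a) (nK x ^+ 2).
  have x_gt0 : 0 < nK x.
    by rewrite norm_gt0; apply: contraTneq ax => ->; rewrite norm0 expr0n /= -leNgt.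
  rewrite -normX -xb addrC; apply/esym/norm_dominant.
  by rewrite nKM normX (exprSr _ 2) ltr_pM2r.
have b_le : nK b <= nK a * nK x.
  by rewrite -xb normD_le ?normX ?nKM // (exprSr _ 2) ler_wpM2r.
have : nK b ^+ 2 <= nK a ^+ 3.
  apply: (@le_trans _ _ ((nK a * nK x) ^+ 2)).
    by rewrite lerXn2r ?nnegrE ?mulr_ge0.
  by rewrite exprMn (exprSr _ 2) ler_wpM2l // exprn_ge0.
by rewrite leNgt ab.
Qed.

Lemma prime_mod3 : (p %% 3 = 1 \/ p %% 3 = 2)%N.
Proof.
have : (p %% 3 < 3)%N by rewrite ltn_mod.
have : (p %% 3 != 0)%N by rewrite -/(3 %| p)%N dvdn_prime2 // neq_ltn hp3.
by case: (p %% 3)%N => [|[|[|]]] // _ _; [left|right].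
Qed.

(** Norms are recorded through their cubes, which keeps the statement inside the rationals. *)
Lemma roots_Delta1 a b : Delta1 p nK a b ->
  exists s, [/\ root_multiset (cubic a b) s, all (fun x => nK x ^+ 3 == nK b) s
    & size s = 3%N /\ (p %% 3 = 1)%N \/ size s = 1%N /\ (p %% 3 = 2)%N].
Proof.
move=> [ab /[dup] cb /cbrt_exists_cube[y yb]].
have b0 : b != 0 by case: cb.
suff [s [Ps hs]] : exists s, root_multiset (cubic a b) s /\
    (size s = 3%N /\ (p %% 3 = 1)%N \/ size s = 1%N /\ (p %% 3 = 2)%N).
  exists s; split=> //; apply/allP => x /(root_multiset_root _ _ _ _ Ps).
  by rewrite root_cubic => /eqP xb; rewrite (norm_root_Delta1 a b x).
have y0 : y != 0 by apply: contraNneq b0 => y0; rewrite -yb y0 expr0n.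
have ny_gt0 : 0 < nK y by rewrite norm_gt0.
have ay : nK a < nK y ^+ 2.
  rewrite -(ltr_pXn2r (n := 3)) ?nnegrE ?exprn_ge0 //.
  by rewrite -exprM mulnC exprM -[nK y ^+ 3]normX yb.
have A1 : nK (a / y ^+ 2) < 1.
  by rewrite normf_div normX ltr_pdivrMr ?exprn_gt0 // mul1r.
(* Substituting [x = y * z] and dividing by [y ^+ 3 = b] gives z^3 + (a/y^2) z = 1, a perturbation
   of z^3 = 1. *)
have [|z [z1 zz]] := hensel_depressed (a / y ^+ 2) 1 1 A1 norm1.
  by rewrite expr1n subrr norm0.
have nz : nK z = 1 by rewrite -norm1; apply: norm_near; rewrite norm1.
have z0 : z != 0 by rewrite -norm_eq0 nz oner_eq0.
set r := y * z; have rb : r ^+ 3 + a * r = b.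
  by rewrite -yb -[y ^+ 3]mulr1 -z1 /r; field.
have n3 : 3%:R != 0 :> K by exact: natr_neq0.
(* The quadratic cofactor has discriminant -3r^2(1 + 4a/(3r^2)). *)
have [|w [w1 ww]] := sqrt_one_plus (4%:R * a / (3%:R * r ^+ 2)).
  rewrite normf_div nKM [nK (3%:R * _)]nKM norm3 mul1r.
  rewrite normX nKM nz mulr1 ltr_pdivrMr ?exprn_gt0 // mul1r.
  by apply: le_lt_trans ay; rewrite ler_piMl // norm_nat_le1.
have w0 : w != 0 by rewrite -norm_eq0 w1 oner_eq0.
have r0 : r != 0 by rewrite mulf_neq0.
clearbody r.
have disc : - 3%:R * r ^+ 2 - 4%:R * a = - 3%:R * (r * w) ^+ 2.
  by rewrite exprMn ww; field; rewrite r0 n3.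
have [p3|p3] := prime_mod3.
  have [v v3] := proj2 minus3_square p3.
  exists [:: r; (v * (r * w) - r) / 2%:R; (- (v * (r * w)) - r) / 2%:R].
  split; last by left.
  apply: cubic_roots3 => //; first exact: two_neq0.
  by rewrite disc exprMn v3.
exists [:: r]; split; last by right.
apply: cubic_root1 => // v; rewrite disc => vE.
suff /minus3_square : exists y, y ^+ 2 = - 3%:R :> K by rewrite p3.
(* A square root of the discriminant divided by [r * w] would be a square root of -3. *)
by exists (v / (r * w)); rewrite expr_div_n vE mulfK // expf_neq0 // mulf_neq0.
Qed.

Lemma roots_Delta3 a b : a != 0 -> Delta3 nK a b ->
  exists r, [/\ nK r = nK b / nK a,
    sqrt_exists p nK (- a) -> exists s t, [/\ root_multiset (cubic a b) [:: r; s; t],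
      nK s ^+ 2 = nK a & nK t ^+ 2 = nK a]
    & ~ sqrt_exists p nK (- a) -> root_multiset (cubic a b) [:: r]].
Proof.
rewrite /Delta3 => a0 ab.
have na_gt0 : 0 < nK a by rewrite norm_gt0.
have e1 : nK (b ^+ 2 / a ^+ 3) < 1.
  by rewrite normf_div !normX ltr_pdivrMr ?exprn_gt0 // mul1r.
(* Substituting [x = (b / a) * z] and dividing by [b] gives (b^2/a^3) z^3 + z = 1, a perturbation of
   z = 1. *)
have [|||||z [z1 zz]] := hensel_cubic (b ^+ 2 / a ^+ 3) 0 1 (- 1) 1.
- exact: ltW.
- by rewrite norm0.
- by rewrite norm1.
- by rewrite !expr1n mul0r !mulr1 addr0 addrK.
- rewrite -[RHS]norm1 expr1n mulr0 mul0r addr0 mulr1; apply: norm_dominant.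
  by rewrite norm1 nKM norm3 mul1r.
have nz : nK z = 1 by rewrite -norm1; apply: norm_near; rewrite norm1.
pose r := b / a * z.
have nr : nK r = nK b / nK a by rewrite nKM nz mulr1 normf_div.
have rb : r ^+ 3 + a * r = b.
  apply/eqP; rewrite -subr_eq0 -(mulr0 b) -z1 -subr_eq0; apply/eqP.
  by rewrite /r; field.
have ra : nK r ^+ 2 < nK a.
  by rewrite nr expr_div_n ltr_pdivrMr ?exprn_gt0 // -exprS.
(* This makes the square root of the discriminant dominate [r], so the other two roots take its
   norm. *)
have r_lt y : nK y ^+ 2 = nK a -> nK r < nK y.
  by move=> ya; rewrite -(ltr_pXn2r (n := 2)) ?nnegrE // ya.
clearbody r.
have n2 := two_neq0; have n4 : nK 4%:R = 1 by rewrite (natrM _ 2 2) nKM norm2 mulr1.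
have n40 : 4%:R != 0 :> K by exact: natr_neq0.
(* The quadratic cofactor has discriminant -4a(1 + 3r^2/(4a)). *)
have [|w [w1 ww]] := sqrt_one_plus (3%:R * r ^+ 2 / (4%:R * a)).
  by rewrite normf_div [nK (3%:R * _)]nKM nKM normX norm3 n4 !mul1r ltr_pdivrMr // mul1r.
have w0 : w != 0 by rewrite -norm_eq0 w1 oner_eq0.
have disc : - 3%:R * r ^+ 2 - 4%:R * a = - a * (2%:R * w) ^+ 2.
  by rewrite exprMn ww; field; rewrite a0 n40.
have na0 : - a != 0 by rewrite oppr_eq0.
exists r; split=> // [/(sqrt_existsP _ na0)[y ya]|nsq].
  have nya : nK y ^+ 2 = nK a by rewrite -normX ya normN.
  pose v := y * (2%:R * w).
  have nv : nK v = nK y by rewrite !nKM norm2 w1 !mulr1.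
  exists ((v - r) / 2%:R), ((- v - r) / 2%:R); split.
  - by apply: cubic_roots3 => //; rewrite disc /v exprMn ya.
  - rewrite normf_div norm2 divr1 addrC norm_dominant nv ?normN //.
    exact: r_lt.
  - rewrite normf_div norm2 divr1 addrC norm_dominant ?normN nv //.
    exact: r_lt.
apply: cubic_root1 => // v; rewrite disc => vE; apply: nsq.
apply/(sqrt_existsP _ na0); exists (v / (2%:R * w)).
by rewrite expr_div_n vE mulfK // expf_neq0 // mulf_neq0.
Qed.
End Qp.

(** * The nine cases, read off from the norms of the roots *)

Theorem mainTheorem1 (p : nat) (K : fieldType) (nK : K -> rat)
  (HK : is_Qp p nK) (hp : prime p) (hp3 : (3 < p)%N)
  (a b : K) (hab : a * b != 0)
  (hD : Delta1 p nK a b \/ Delta3 nK a b) :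
  let P := cubic a b in
  let U := Zp_units nK in
  let M := Zp_nonunits nK in
  let O := Qp_nonint nK in
  ((* 1 *)
      solvable_in P U 3 <->
        Delta1 p nK a b /\ nK b = 1 /\ (p %% 3 = 1)%N) /\
  ((* 2 *)
      solvable_in P M 3 <->
        (Delta1 p nK a b /\ nK b < 1 /\ (p %% 3 = 1)%N) \/
        (Delta3 nK a b /\ nK a < 1 /\ sqrt_exists p nK (- a))) /\
  ((* 3 *)
      solvable_in P O 3 <->
        (Delta1 p nK a b /\ 1 < nK b /\ (p %% 3 = 1)%N) \/
        (Delta3 nK a b /\ nK a < nK b /\ sqrt_exists p nK (- a))) /\
  ((* 4 *)
      solvable_in2 P M 1 U 2 <->
        Delta3 nK a b /\ nK a = 1 /\ sqrt_exists p nK (- a)) /\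
  ((* 5 *)
      solvable_in2 P U 1 O 2 <->
        Delta3 nK a b /\ nK a = nK b /\ sqrt_exists p nK (- a)) /\
  ((* 6 *)
      solvable_in2 P M 1 O 2 <->
        Delta3 nK a b /\ nK b < nK a /\ 1 < nK a /\ sqrt_exists p nK (- a)) /\
  ((* 7 *)
      solvable_in P U 1 <->
        (Delta1 p nK a b /\ nK b = 1 /\ (p %% 3 = 2)%N) \/
        (Delta3 nK a b /\ nK a = nK b /\ ~ sqrt_exists p nK (- a))) /\
  ((* 8 *)
      solvable_in P M 1 <->
        (Delta1 p nK a b /\ nK b < 1 /\ (p %% 3 = 2)%N) \/
        (Delta3 nK a b /\ nK b < nK a /\ ~ sqrt_exists p nK (- a))) /\
  ((* 9 *)
      solvable_in P O 1 <->
        (Delta1 p nK a b /\ 1 < nK b /\ (p %% 3 = 2)%N) \/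
        (Delta3 nK a b /\ nK a < nK b /\ ~ sqrt_exists p nK (- a))).
Proof.
move=> P U M O.
have [a0 b0] : a != 0 /\ b != 0 by apply/andP; rewrite -negb_or -mulf_eq0.
have ge0 := Qp_norm_ge0 HK.
have a_gt0 : 0 < nK a by rewrite (norm_gt0 p K nK HK).
have b_gt0 : 0 < nK b by rewrite (norm_gt0 p K nK HK).
have [D1|D3] := hD.
  have nD3 : ~ Delta3 nK a b by rewrite /Delta3; case: D1 => /lt_trans h _ /h; rewrite ltxx.
  have [s [Ps /allP hs hn]] := roots_Delta1 p K nK HK hp hp3 a b D1.
  (* All roots share one norm here, so each of the three sets contains either all of them or
     none. *)
  have count_cst (A : pred K) (c : bool) : (forall x, nK x ^+ 3 = nK b -> A x = c) ->
      count A s = (c * size s)%N.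
    move=> Ac; rewrite (eq_in_count (a2 := fun=> c)) => [|x /hs/eqP/Ac //].
    by case: (c); rewrite ?count_predT ?count_pred0 ?mul1n.
  have cU : count U s = ((nK b == 1)%R * size s)%N.
    by apply: count_cst => x <-; rewrite pexpr_eq1.
  have cM : count M s = ((nK b < 1)%R * size s)%N.
    by apply: count_cst => x <-; rewrite expr_lt1.
  have cO : count O s = ((1 < nK b)%R * size s)%N.
    by apply: count_cst => x <-; rewrite expr_gt1.
  rewrite !(solvable_inE K P _ _ _ Ps) !(solvable_in2E K P _ _ _ _ _ Ps).
  rewrite !all_count cU cM cO.
  by case: hn => -[-> ->]; case: (ltgtP (nK b) 1) => h1 /=;
    intuition (done || (exfalso; lra)).
have nD1 : ~ Delta1 p nK a b by case=> /lt_trans /(_ D3); rewrite ltxx.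
have [r [nr sq nsq]] := roots_Delta3 p K nK HK hp hp3 a b a0 D3.
have rU : U r = (nK a == nK b).
  by rewrite /U /Zp_units nr -(divff (lt0r_neq0 a_gt0)) eqr_div ?lt0r_neq0 //
    (inj_eq (mulIf (lt0r_neq0 a_gt0))) eq_sym.
have rM : M r = (nK b < nK a) by rewrite /M /Zp_nonunits nr ltr_pdivrMr // mul1r.
have rO : O r = (nK a < nK b) by rewrite /O /Qp_nonint nr ltr_pdivlMr // mul1r.
(* From |b|^2 < |a|^3 and |a| at most 1 follows |b| < |a|. Thus |b| at least |a| forces |a| > 1,
   which excludes the impossible combinations in the final case split. *)
have small : nK a <= 1 -> nK b < nK a.
  move=> a1; rewrite -(ltr_pXn2r (n := 2)) ?nnegrE //; apply: lt_le_trans D3 _.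
  by rewrite exprS ler_piMl // exprn_ge0.
have na0 : - a != 0 by rewrite oppr_eq0.
have [S|S] := sqrt_exists_dec p K nK HK hp (- a) na0.
  have [s [t [Ps ns nt]]] := sq S.
  have xU x : nK x ^+ 2 = nK a -> U x = (nK a == 1).
    by move=> <-; rewrite pexpr_eq1.
  have xM x : nK x ^+ 2 = nK a -> M x = (nK a < 1).
    by move=> <-; rewrite expr_lt1.
  have xO x : nK x ^+ 2 = nK a -> O x = (1 < nK a).
    by move=> <-; rewrite expr_gt1.
  rewrite !(solvable_inE K P _ _ _ Ps) !(solvable_in2E K P _ _ _ _ _ Ps) /=.
  rewrite rU rM rO !xU // !xM // !xO //.
  move: small; case: (ltgtP (nK a) 1) => h1; case: (ltgtP (nK a) (nK b)) => h2 //= small;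
    intuition (done || (exfalso; lra)).
(* Only [r] remains, so every statement about three roots fails and the others depend on comparing
   |a| with |b|. *)
have Ps := nsq S.
rewrite !(solvable_inE K P _ _ _ Ps) !(solvable_in2E K P _ _ _ _ _ Ps) /=.
rewrite rU rM rO.
by case: (ltgtP (nK a) (nK b)) => h2 //=; intuition (done || (exfalso; lra)).
Qed.
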